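(* Let $\alpha>2$ and $\gamma=1/\alpha$. Assume that $U$ satisfies $\lim_{t\to\infty}U(tx)/U(t)=x^{\gamma}$ for every $x>0$, and that there exist $t_0>0$ and $\eta\in[0,1)$ such that $U(tx)/U(t)\ge(1-\eta)x^{\gamma}+\eta$ for all $t\ge t_0$ and $x\ge 1$. Assume that the network is generated under either the ordered Norros-Reittu model or the ordered Chung-Lu model. Let $k(n)$ be such that $k(n)\to\infty$ and $k(n)\,(\log n)^{\alpha}/n^{\frac{1}{4\alpha+1}}\to0$ as $n\to\infty$. Let $a(t)=\gamma U(t)$ for $t>1$. Then for $q\in\{1,2\}$, as $n\to\infty$, $$\sqrt{k(n)}\left|\frac{\hat I^{(q)}_D(n)}{a(n/k(n))}-\frac{\hat I^{(q)}_W(n)}{a(n/k(n))}\right|\xrightarrow{p}0 .$$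
   Context: Notation: $[n]=\{1,\dots,n\}$, $x\wedge y=\min(x,y)$, and $\xrightarrow{p}$ denotes convergence in probability. Let $F$ be a continuous distribution function supported on the positive reals, and let $W_1,W_2,\dots,W_n$ be independent with distribution function $F$. Let $W_{(1)}(n)\ge W_{(2)}(n)\ge\dots\ge W_{(n)}(n)$ be their decreasing order statistics and $L(n)=\sum_{i=1}^n W_i$. Let $U(t)=F^{\leftarrow}(1-1/t)$ for $t\ge1$, where $F^{\leftarrow}(y)=\inf\{x:F(x)\ge y\}$. Ordered random graph models on $n$ nodes: $\{A_{ij}(n)\}_{i,j=1}^n$ is a random symmetric adjacency matrix whose entries with $1\le i\le j\le n$ are, conditionally on $\{W_{(i)}(n)\}_{i\in[n]}$, independent. In the (ordered) Norros-Reittu model, $A_{ij}(n)\mid\{W_{(i)}(n)\}_{i\in[n]}\sim\mathrm{Poisson}\left(W_{(i)}(n)W_{(j)}(n)/L(n)\right)$ for $1\le i\le j\le n$. In the (ordered) Chung-Lu model, $A_{ij}(n)\mid\{W_{(i)}(n)\}_{i\in[n]}\sim\mathrm{Bernoulli}\left(\frac{W_{(i)}(n)W_{(j)}(n)}{L(n)}\wedge1\right)$ for $1\le i\le j\le n$. The degree of node $i$ is $D_i(n)=\sum_{j=1}^n A_{ij}(n)$, and $D_{(1)}(n)\ge D_{(2)}(n)\ge\dots\ge D_{(n)}(n)$ are the decreasing order statistics of the degrees $D_1(n),\dots,D_n(n)$. $k(n)$ denotes a sequence of positive integers. For $q=1,2$, $$\hat I^{(q)}_D(n)=\frac{1}{k(n)-1}\sum_{i=1}^{k(n)-1}\left(\frac{i}{k(n)-1}\right)^{q-1}\left(D_{(i)}(n)-D_{(k(n))}(n)\right),$$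 and $\hat I^{(q)}_W(n)$ is defined by the same formula with every $D_{(i)}(n)$ replaced by $W_{(i)}(n)$. *)

(* Defs.v *)
From HB Require Import structures.
From mathcomp Require Import all_boot all_order all_algebra.
From mathcomp Require Import all_classical all_reals all_analysis.

Set Implicit Arguments.
Unset Strict Implicit.
Unset Printing Implicit Defensive.

Import Order.TTheory GRing.Theory Num.Theory.
Import numFieldNormedType.Exports.

Local Open Scope classical_set_scope.
Local Open Scope ring_scope.

Section Deterministic.
Context {R : realType}.

(* Indices of order statistics are 1-based: [ostat x 1] is the maximum and
   [ostat x n] the minimum.  Outside 1..n the value is irrelevant. *)
Definition ostat n (x : 'I_n -> R) (i : nat) : R :=
  nth 0 (sort (fun u v => v <= u) [seq x j | j <- enum 'I_n]) i.-1.

Definition quantile (F : R -> R) (y : R) : R := inf [set x | y <= F x].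

(* Only t > 1 is meaningful: for 0 < t <= 1 the infimum is over all of R, and
   [inf] then returns the dummy value 0. *)
Definition tailU (F : R -> R) (t : R) : R := quantile F (1 - t^-1).

Definition Ihat n (q k : nat) (x : 'I_n -> R) : R :=
  (k.-1)%:R^-1 *
  \sum_(1 <= i < k) (i%:R / (k.-1)%:R) ^+ q.-1 * (ostat x i - ostat x k).

End Deterministic.

Section Probability.
Context {d : measure_display} {T : measurableType d} {R : realType}.
Variable P : probability T R.

(* Taking some of the B i to be setT gives the product rule for subfamilies. *)
Definition independent_RVs (I : finType) (X : I -> {RV P >-> R}) : Prop :=
  forall B : I -> set R, (forall i, measurable (B i)) ->
    P (\bigcap_i (X i @^-1` B i)) = (\prod_i fine (P (X i @^-1` B i)))%:E.

Definition sigma_generated (I : Type) (X : I -> T -> R) : set (set T) :=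
  <<s \bigcup_i preimage_set_system setT (X i) measurable >>.

(* f is a version of the conditional probability P(E | G). *)
Definition cond_prob (G : set (set T)) (E : set T) (f : T -> R) : Prop :=
  [/\ forall B : set R, measurable B -> G (f @^-1` B),
      P.-integrable setT (EFin \o f)
    & forall B, G B -> (\int[P]_(w in B) (f w)%:E = P (E `&` B))%E].

(* kappa is a regular conditional distribution of X given G. *)
Definition cond_law (G : set (set T)) (X : {RV P >-> nat})
    (kappa : T -> set nat -> \bar R) : Prop :=
  forall S : set nat, cond_prob G (X @^-1` S) (fun w => fine (kappa w S)).

(* Versions of P(X i \in S i | G) always exist and are a.s. unique, so the
   quantification over all versions f i is harmless. *)
Definition cond_independent (G : set (set T)) (I : finType) (J : pred I)
    (X : I -> {RV P >-> nat}) : Prop :=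
  forall (S : I -> set nat) (f : I -> T -> R),
    (forall i, J i -> cond_prob G (X i @^-1` S i) (f i)) ->
    cond_prob G (\bigcap_(i in [set i | J i]) (X i @^-1` S i))
      (fun w => \prod_(i | J i) f i w).

End Probability.

Section Networks.
Context {d : measure_display} {T : measurableType d} {R : realType}.
Variables (P : probability T R) (n : nat).
Variables (W : 'I_n -> {RV P >-> R}) (A : 'I_n -> 'I_n -> {RV P >-> nat}).

Definition iid_weights (F : R -> R) : Prop :=
  independent_RVs W /\ forall i x, cdf (W i) x = (F x)%:E.

(* Node i : 'I_n, counted from 0, carries the (i+1)-st largest weight. *)
Definition weight (i : 'I_n) (w : T) : R := ostat (fun j => W j w) i.+1.

Definition edge_rate (i j : 'I_n) (w : T) : R :=
  weight i w * weight j w / \sum_l W l w.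

Definition ordered_graph (law : R -> set nat -> \bar R) : Prop :=
  [/\ forall i j w, A i j w = A j i w,
      cond_independent (sigma_generated weight)
        (fun p : 'I_n * 'I_n => (p.1 <= p.2)%N) (fun p => A p.1 p.2)
    & forall i j : 'I_n, (i <= j)%N ->
        cond_law (sigma_generated weight) (A i j)
          (fun w => law (edge_rate i j w))].

(* The second argument of [poisson_prob] is not used by its definition. *)
Definition norros_reittu : Prop :=
  ordered_graph (fun r => poisson_prob r 0%N).

Definition chung_lu : Prop :=
  ordered_graph
    (fun r => pushforward (bernoulli_prob (Num.min r 1)) nat_of_bool).

Definition degree (i : 'I_n) (w : T) : R := (\sum_j A i j w)%N%:R.

End Networks.

(* Each X n may live on its own probability space: the limit is a constant, so
   only the law of each X n matters. *)
Definition cvg_in_probability {R : realType} (d : nat -> measure_display)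
    (T : forall n, measurableType (d n)) (P : forall n, probability (T n) R)
    (X : forall n, T n -> R) (l : R) : Prop :=
  forall eps : R, 0 < eps ->
    P n [set w | eps < `|X n w - l|] @[n --> \oo] --> 0%E.

(* Main.v *)
Require Import Defs.
From HB Require Import structures.
From mathcomp Require Import all_boot all_order all_algebra.
From mathcomp Require Import all_classical all_reals all_analysis.
From mathcomp Require Import measurable_realfun.
From mathcomp Require Import ring lra.

Set Implicit Arguments.
Unset Strict Implicit.
Unset Printing Implicit Defensive.

Import Order.TTheory GRing.Theory Num.Theory.
Import numFieldNormedType.Exports.

Local Open Scope classical_set_scope.
Local Open Scope ring_scope.

(** Why the two estimators agree.  An estimator [Ihat q k] is an average of
    differences of order statistics, with coefficients in [0, 1], and order
    statistics are 1-Lipschitz for the sup norm.  Hence the degree version and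
    the weight version differ by at most twice
    [max_i |degree i - weight i|] ([Ihat_lipschitz]), and it suffices that this
    maximum be, with high probability, of smaller order than the scale
    [U (n / k) / sqrt k].

    Given the weights, [degree i] is a sum of independent edge counts.  Its
    conditional mean is exactly [weight i] as soon as all edge rates are at most
    1, that is, as soon as the square of the largest weight is below the total
    weight.  On that event both edge laws have a Laplace transform dominated by
    the Poisson one ([subpoisson_mgf]), so that a single Chernoff argument
    covers both models: if all weights are at most [M], then a given degree
    deviates by [delta] with probability at most of order
    [exp (- delta ^ 2 / (32 M))] ([degree_deviation]).

    Fix [beta] with [gamma < beta < min (1/2, 3 gamma / 2)] and put
    [M = n ^ beta] and [delta = c n ^ (3 gamma / 4)].
    - Regular variation gives [U t <= C t ^ g] for every [g > gamma]
      ([tailU_le_powR]), so that with high probability no weight exceeds [M]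
      ([expected_exceedances_le]).
    - As [2 beta < 1], the total weight, which is of order [n], exceeds
      [M ^ 2]: cut the indices into somewhat more than [M ^ 2] blocks, of a
      length that is a power of [n]; every block contains an entry above a
      fixed threshold, except with exponentially small probability
      ([typicalC_bound], [near_blocks]).
    - The lower bound on [U] gives [U t >= c t ^ gamma] ([tailU_ge_powR]), and
      the growth condition on [k] gives [k <= n ^ (gamma / 4)]
      ([near_k_le]).  As [gamma < 1/2], [U (n / k) / sqrt k] is at least a
      constant times [n ^ (3 gamma / 4)], so that deviations below [delta] are
      harmless ([near_noise_below_signal]).
    - As [beta < 3 gamma / 2], [delta ^ 2 / M] is a positive power of [n], and
      the Chernoff bound beats the polynomially many terms of the union
      bound. *)

(** * Order statistics *)

Section OrderStatistics.
Context {R : realType}.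
Implicit Types (n i k q : nat) (c delta : R).

Let geR : rel R := fun u v => v <= u.

Let geR_trans : transitive geR.
Proof. by move=> v u w uv vw; exact: le_trans vw uv. Qed.

Let geR_total : total geR.
Proof. by move=> u v; rewrite /geR orbC le_total. Qed.

Let sorted_nth_gt (s : seq R) i c : sorted geR s -> (i < size s)%N ->
  (c < nth 0 s i) = (i < count (fun u => (c < u)%R) s)%N.
Proof.
elim: s i => [|u s IHs] i //= us.
have u_max : all (geR u) s := order_path_min geR_trans us.
have [cu|uc] := boolP (c < u).
  by case: i => [|i] //; rewrite ltnS add1n ltnS => /IHs ->//; exact: path_sorted us.
move=> i_s; rewrite add0n.
have /eqP -> : count (fun v => c < v) s == 0%N.
  rewrite -leqn0 leqNgt -has_count; apply/hasPn => v vs.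
  by rewrite -leNgt (le_trans (allP u_max _ vs))// leNgt.
rewrite ltn0; apply/negbTE; rewrite -leNgt.
case: i i_s => [|i] i_s /=; first by rewrite leNgt.
by rewrite (le_trans (allP u_max _ (mem_nth 0 i_s)))// leNgt.
Qed.

Let ostat_sorted n (x : 'I_n -> R) :
  sorted geR (sort geR [seq x j | j <- enum 'I_n]).
Proof. exact: sort_sorted. Qed.

(** The counting description of order statistics, which replaces sorting in all
    that follows. *)
Lemma ostat_gt n (x : 'I_n -> R) i c : (i < n)%N ->
  (c < ostat x i.+1) = (i < #|[pred j | (c < x j)%R]|)%N.
Proof.
move=> i_n; rewrite /ostat /= sorted_nth_gt//; last first.
  by rewrite size_sort size_map size_enum_ord.
congr (_ < _)%N; rewrite count_sort count_map.
by rewrite cardE size_filter -enumT; apply: eq_count.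
Qed.

Lemma ostat_default n (x : 'I_n -> R) i : (n <= i)%N -> ostat x i.+1 = 0.
Proof.
by move=> ni; rewrite /ostat nth_default// size_sort size_map size_enum_ord.
Qed.

Lemma ostat0 n (x : 'I_n -> R) : ostat x 0 = ostat x 1.
Proof. by []. Qed.


Let ostat_shift n (x y : 'I_n -> R) delta i :
  (i < n)%N -> (forall j, x j <= y j + delta) ->
  ostat x i.+1 <= ostat y i.+1 + delta.
Proof.
move=> i_n xy; rewrite leNgt; apply/negP; rewrite ostat_gt// => x_many.
have := ltxx (ostat y i.+1); rewrite ostat_gt// (leq_trans x_many)//.
apply/subset_leq_card/fintype.subsetP => j; rewrite !inE => xj.
by rewrite -(ltrD2r delta) (lt_le_trans xj).
Qed.

(** Order statistics are 1-Lipschitz for the sup norm: moving each entry by at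
    most [delta] moves every threshold count by a shift of at most [delta] in
    the threshold. *)
Lemma ostat_lipschitz n (x y : 'I_n -> R) delta i : 0 <= delta ->
  (forall j, `|x j - y j| <= delta) -> `|ostat x i - ostat y i| <= delta.
Proof.
move=> delta0 xy; wlog [{}i ->] : i / exists i', i = i'.+1.
  by move=> IH; case: i => [|i]; [rewrite !ostat0|]; apply: IH; eexists.
have [i_n|n_i] := ltnP i n; last by rewrite !ostat_default// subrr normr0.
rewrite ler_norml; apply/andP; split.
  rewrite lerBrDr addrC -lerBDr opprK; apply: ostat_shift => // j.
  by have := xy j; rewrite ler_norml => /andP[]; lra.
rewrite lerBlDr addrC; apply: ostat_shift => // j.
by have := xy j; rewrite ler_norml => /andP[]; lra.
Qed.

Let map_ostat n (x : 'I_n -> R) :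
  [seq ostat x j.+1 | j : 'I_n <- enum 'I_n] =
  sort geR [seq x j | j <- enum 'I_n].
Proof.
apply: (@eq_from_nth _ 0); first by rewrite size_sort !size_map.
move=> i; rewrite size_map size_enum_ord => i_n.
by rewrite (nth_map (Ordinal i_n)) ?size_enum_ord// nth_enum_ord.
Qed.

Lemma ostat_ostat n (x : 'I_n -> R) k :
  ostat (fun j : 'I_n => ostat x j.+1) k = ostat x k.
Proof. by rewrite /ostat map_ostat [sort _ (sort _ _)]sorted_sort. Qed.

Lemma sum_ostat n (x : 'I_n -> R) : \sum_(j < n) ostat x j.+1 = \sum_j x j.
Proof.
have sumE (y : 'I_n -> R) : \sum_j y j = \sum_(u <- [seq y j | j <- enum 'I_n]) u.
  by rewrite big_map -big_enum.
rewrite (sumE (fun j : 'I_n => ostat x j.+1)) map_ostat (sumE x).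
by apply: perm_big; rewrite perm_sort.
Qed.

Lemma ostat_mem n (x : 'I_n -> R) (j : 'I_n) : exists l, ostat x j.+1 = x l.
Proof.
have : ostat x j.+1 \in [seq x l | l <- enum 'I_n].
  by rewrite -(mem_sort geR); apply: mem_nth; rewrite size_sort size_map size_enum_ord /=.
by case/mapP => l _ ->; exists l.
Qed.

Lemma ostat_sum_ge n (x : 'I_n -> R) K c : (K < n)%N -> 0 <= c ->
  (forall j, 0 <= x j) -> c < ostat x K.+1 -> K.+1%:R * c <= \sum_j x j.
Proof.
move=> K_n c0 x0; rewrite ostat_gt// => many.
apply: (@le_trans _ _ (\sum_(j | c < x j) c)).
  by rewrite sumr_const -[leRHS]mulr_natl ler_wpM2r// ler_nat.
rewrite [leRHS](bigID (fun j => c < x j))/= -[leLHS]addr0 lerD//.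
  by apply: ler_sum => j /ltW.
exact: sumr_ge0.
Qed.

(** The coefficients of the average lie in [0, 1], and each summand is a
    difference of two order statistics, whence the factor 2. *)
Lemma Ihat_lipschitz n q k (x y : 'I_n -> R) delta : 0 <= delta ->
  (forall j, `|x j - y j| <= delta) -> `|Ihat q k x - Ihat q k y| <= 2 * delta.
Proof.
move=> delta0 xy; rewrite /Ihat -mulrBr -sumrB normrM normfV normr_nat.
have [->|k1_gt0] := posnP k.-1; first by rewrite !mulr0n !invr0 mul0r mulr_ge0.
have k1_gt0R : 0 < (k.-1)%:R :> R by rewrite ltr0n.
rewrite mulrC ler_pdivrMr//; apply: (le_trans (ler_norm_sum _ _ _)).
rewrite [leRHS](_ : _ = \sum_(1 <= i < k) (2 * delta)); last first.
  by rewrite sumr_const_nat subn1 mulr_natr.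
rewrite !big_nat; apply: ler_sum => i /andP[_ i_k]; rewrite -mulrBr normrM.
have w1 : `|(i%:R / (k.-1)%:R : R) ^+ q.-1| <= 1.
  rewrite ger0_norm ?exprn_ge0 ?divr_ge0// exprn_ile1 ?divr_ge0//.
  by rewrite ler_pdivrMr// mul1r ler_nat -ltnS prednK// (leq_ltn_trans _ i_k).
rewrite -[leRHS]mul1r ler_pM//.
have -> : ostat x i - ostat x k - (ostat y i - ostat y k) =
   (ostat x i - ostat y i) - (ostat x k - ostat y k) by ring.
by rewrite (le_trans (ler_normB _ _))// mulr_natl mulr2n; apply: lerD; exact: ostat_lipschitz.
Qed.

Lemma Ihat_ostat n q k (x : 'I_n -> R) :
  Ihat q k (fun j : 'I_n => ostat x j.+1) = Ihat q k x.
Proof.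
by rewrite /Ihat; congr (_ * _); apply: eq_bigr => i _; rewrite !ostat_ostat.
Qed.

(** An order statistic exceeds [c] iff some set of enough indices has all its
    entries above [c], a finite union of finite intersections. *)
Lemma measurable_ostat d (T : measurableType d) n (X : 'I_n -> T -> R) i :
  (forall j, measurable_fun setT (X j)) ->
  measurable_fun setT (fun w => ostat (fun j => X j w) i).
Proof.
move=> mX; wlog [{}i ->] : i / exists i', i = i'.+1.
  by move=> IH; case: i => [|i]; [apply: (IH 1%N); exists 0%N|apply: IH; eexists].
have [i_n|n_i] := ltnP i n; last first.
  by rewrite (_ : (fun _ => _) = cst 0)//; apply/funext => w; rewrite ostat_default.
apply: (measurability _ (RGenOInfty.measurableE R)) => //.
move=> _ [_ [c ->] <-]; rewrite setTI.
rewrite (_ : _ @^-1` _ =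
    \bigcup_(J in [set J : {set 'I_n} | (i < #|J|)%N])
      \bigcap_(j in [set j | j \in J]) (X j @^-1` `]c, +oo[)).
  apply: fin_bigcup_measurable => // J _; apply: fin_bigcap_measurable => // j _.
  by rewrite -[_ @^-1` _]setTI; exact: mX.
apply/seteqP; split=> w /=; rewrite in_itv/= andbT ostat_gt//.
  move=> many; exists [set j | (c < X j w)%R]%SET; first by rewrite /= cardsE.
  by move=> j /=; rewrite inE in_itv/= andbT.
move=> [J /= iJ JX]; rewrite (leq_trans iJ)//.
apply/subset_leq_card/fintype.subsetP => j jJ; rewrite inE.
by have /= := JX j jJ; rewrite in_itv/= andbT.
Qed.

Lemma measurable_Ihat d (T : measurableType d) n q k (X : 'I_n -> T -> R) :
  (forall j, measurable_fun setT (X j)) ->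
  measurable_fun setT (fun w => Ihat q k (fun j => X j w)).
Proof.
move=> mX; rewrite /Ihat; apply: measurable_funM => //.
apply: measurable_sum => i; apply: measurable_funM => //.
by apply: measurable_funB; exact: measurable_ostat.
Qed.

End OrderStatistics.

(** * Chernoff bound for conditionally independent counts *)

Section Chernoff.
Context d {T : measurableType d} {R : realType} (P : probability T R).

Lemma union_bound (I : finType) (Q : pred I) (A : set T) (B : I -> set T) :
  measurable A -> (forall i, Q i -> measurable (B i)) ->
  (forall w, A w -> exists2 i, Q i & B i w) ->
  (P A <= \sum_(i | Q i) P (B i))%E.
Proof.
move=> mA mB AB; rewrite bigfs ?index_enum_uniq//; last first.
  by move=> i _; rewrite mem_index_enum.
exact: content_sub_fsum.
Qed.

Lemma measurable_sumn I (r : seq I) (X : I -> T -> nat) :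
  (forall i, measurable_fun setT (X i)) ->
  measurable_fun setT (fun w => \sum_(i <- r) X i w)%N.
Proof.
move=> mX; elim: r => [|i r IHr].
  by under eq_fun do rewrite big_nil; exact: measurable_cst.
under eq_fun do rewrite big_cons; exact: measurable_fun_addn.
Qed.

(** An exponential Markov inequality for a sum of counts that are conditionally
    independent given some sigma-algebra containing [B], with conditional point
    masses [kap j m].  Once the counts are truncated at [N], the tail event is a
    finite union of events [X = v], whose probabilities are integrals of
    products of point masses, and the sum over [v] of the tilted products
    factorizes into a product of truncated Laplace transforms.  The bound does
    not depend on [N], so it survives the limit. *)
Lemma probability_chernoff n (X : 'I_n -> T -> nat)
    (kap : 'I_n -> nat -> T -> R) (B : set T) (theta s Lam : R) :
  (forall j, measurable_fun setT (X j)) -> measurable B ->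
  (forall v : 'I_n -> nat,
     P.-integrable setT (EFin \o (fun w => \prod_j kap j (v j) w))) ->
  (forall v : 'I_n -> nat, (\int[P]_(w in B) (\prod_j kap j (v j) w)%:E =
     P (\bigcap_j (X j @^-1` [set v j]) `&` B))%E) ->
  (forall N w, B w ->
     \prod_j \sum_(m < N) expR (theta * m%:R) * kap j m w <= expR Lam) ->
  (P (B `&` [set w | (s <= theta * (\sum_j X j w)%N%:R)%R]) <=
    (expR (Lam - s))%:E)%E.
Proof.
move=> mX mB kap_int kapE kap_mgf.
have mXS j S : measurable (X j @^-1` S) by rewrite -[X in measurable X]setTI; exact: mX.
have mS S : measurable [set w | S (\sum_j X j w)%N].
  have mSum : measurable_fun setT (fun w => (\sum_j X j w)%N).
    exact: measurable_sumn.
  by rewrite -[X in measurable X]setTI; exact: (mSum _ (S : set nat)).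
pose E := B `&` [set w | s <= theta * (\sum_j X j w)%N%:R].
have mE : measurable E by apply: measurableI => //; exact: (mS (fun m => s <= theta * m%:R)).
pose F N := E `&` \bigcap_j (X j @^-1` [set m | (m < N)%N]).
have mF N : measurable (F N).
  by apply: measurableI => //; apply: fin_bigcap_measurable.
have FE : \bigcup_N F N = E.
  apply/seteqP; split => [w [N _ []]//|w Ew].
  exists (\max_j X j w).+1 => //; split => // j _ /=.
  by rewrite ltnS; exact: leq_bigmax.
have F_bound N : (P (F N) <= (expR (Lam - s))%:E)%E.
  pose C (v : {ffun 'I_n -> 'I_N}) := \bigcap_j (X j @^-1` [set (v j : nat)]) `&` B.
  have mC v : measurable (C v).
    by apply: measurableI => //; apply: fin_bigcap_measurable.
  pose Q (v : {ffun 'I_n -> 'I_N}) := s <= theta * (\sum_j v j)%N%:R.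
  have FC w : F N w -> exists2 v, Q v & C v w.
    move=> [[Bw sw] wN]; exists [ffun j => Ordinal (wN j I)].
      by rewrite /Q; under eq_bigr do rewrite ffunE/=.
    by split => // j _ /=; rewrite ffunE.
  apply: (le_trans (union_bound (mF N) (fun v _ => mC v) FC)).
  (* The exponentially tilted conditional probability of [X = v]. *)
  pose g (v : {ffun 'I_n -> 'I_N}) w : R :=
    expR (- s) * \prod_j (expR (theta * (v j)%:R) * kap j (v j) w).
  have gE v w : g v w = expR (theta * (\sum_j v j)%N%:R - s) * \prod_j kap j (v j) w.
    rewrite /g big_split/= -expR_sum mulrA -expRD natr_sum mulr_sumr.
    by congr (expR _ * _); rewrite addrC.
  have g_int v : P.-integrable setT (EFin \o g v).
    rewrite (_ : EFin \o _ = (fun w => (expR (theta * (\sum_j v j)%N%:R - s))%:E *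
       (EFin \o (fun w => (\prod_j kap j (v j) w)%R)) w)%E).
      exact: integrableZl.
    by apply/funext => w /=; rewrite gE EFinM.
  have g_intB v : P.-integrable B (EFin \o g v).
    exact: integrableS (g_int v).
  have gC v : (\int[P]_(w in B) (g v w)%:E =
      (expR (theta * (\sum_j v j)%N%:R - s))%:E * P (C v))%E.
    under eq_integral do rewrite gE EFinM.
    rewrite integralZl//; last exact: integrableS (kap_int _).
    by rewrite kapE.
  apply: (@le_trans _ _ (\sum_v \int[P]_(w in B) (g v w)%:E)%E).
    rewrite big_mkcond/=; apply: lee_sum => v _; rewrite gC.
    case: ifPn => Qv; last by rewrite mule_ge0// lee_fin expR_ge0.
    by rewrite -[leLHS]mul1e lee_wpmul2r// lee_fin
      (le_trans _ (expR_ge1Dx _))// lerDl subr_ge0.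
  rewrite -(integral_sum mB g_intB).
  apply: (@le_trans _ _ (\int[P]_(w in B) (expR (Lam - s))%:E)%E).
    apply: le_integral => //.
    - by apply: integrable_sum.
    - exact: finite_measure_integrable_cst.
    move=> w /set_mem Bw; rewrite sumEFin lee_fin -mulr_sumr.
    rewrite -(bigA_distr_bigA (fun (j : 'I_n) (m : 'I_N) =>
      expR (theta * m%:R) * kap j m w))/=.
    by rewrite [Lam - s]addrC expRD ler_wpM2l ?expR_ge0// kap_mgf.
  rewrite integral_cst// -[leRHS]mule1 lee_wpmul2l ?lee_fin ?expR_ge0//.
  exact: probability_le1.
have := nondecreasing_cvg_mu (mu := P) mF.
rewrite FE => /(_ mE) PF; have {}PF : P (F N) @[N --> \oo] --> P E.
  apply: PF; apply/nondecreasing_seqP => N; apply/subsetPset => w [Ew wN].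
  by split => // j _ /=; rewrite (ltn_trans (wN j I)).
rewrite -(cvg_lim _ PF)//; apply: lime_le; first by apply/cvg_ex; eexists; exact: PF.
by apply: nearW.
Qed.

End Chernoff.

(** * Laplace transforms of the edge laws *)

Section EdgeLaws.
Context {R : realType}.
Implicit Types (r theta : R) (m N : nat).

(** For rates in [0, 1], the Laplace transform of [law r] is at most that of the
    Poisson law of mean [r].  The sums are truncated so that no convergence is
    involved. *)
Definition subpoisson_mgf (law : R -> set nat -> \bar R) :=
  (forall r m, 0 <= fine (law r [set m])) /\
  forall r theta N, 0 <= r <= 1 ->
    \sum_(m < N) expR (theta * m%:R) * fine (law r [set (m : nat)]) <=
    expR (r * (expR theta - 1)).

Lemma expR_partial_sum (x : R) N : 0 <= x ->
  \sum_(m < N) x ^+ m / m`!%:R <= expR x.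
Proof.
move=> x0; have nd : nondecreasing_seq (series (exp_coeff x)).
  by apply/nondecreasing_seqP => m; rewrite seriesSr lerDl exp_coeff_ge0.
have := nondecreasing_cvgn_le nd (is_cvg_series_exp_coeff x) N.
by rewrite /series/= big_mkord.
Qed.

Lemma poisson_subpoisson : subpoisson_mgf (fun r => poisson_prob r 0%N).
Proof.
split=> [r m|r theta N /andP[r0 _]]; first by apply: fine_ge0; exact: measure_ge0.
move: r0; rewrite le_eqVlt => /predU1P[<-|r0].
  rewrite mul0r expR0.
  under eq_bigr do rewrite /poisson_prob ltxx diracE.
  case: N => [|N]; first by rewrite big_ord0.
  rewrite big_ord_recl/= mem_set//= mulr0 expR0 mulr1 big1 ?addr0// => m _.
  by rewrite memNset ?mulr0//= => /esym.
have pE m : fine (poisson_prob r 0%N [set m]) = r ^+ m / m`!%:R * expR (- r).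
  by rewrite /poisson_prob r0 esum_set1 ?lee_fin ?poisson_pmf_ge0//= /poisson_pmf r0.
rewrite (eq_bigr (fun m : 'I_N => expR (- r) * ((r * expR theta) ^+ m / m`!%:R))).
  rewrite -mulr_sumr mulrBr mulr1 addrC expRD ler_wpM2l ?expR_ge0//.
  by rewrite expR_partial_sum// mulr_ge0 ?expR_ge0// ltW.
by move=> m _; rewrite pE expRM_natr exprMn; ring.
Qed.

Lemma bernoulli_subpoisson :
  subpoisson_mgf (fun r => pushforward (bernoulli_prob (Num.min r 1)) nat_of_bool).
Proof.
split=> [r m|r theta N /andP[r0 r1]]; first by apply: fine_ge0; exact: measure_ge0.
have pE m : fine (pushforward (bernoulli_prob (Num.min r 1)) nat_of_bool [set m]) =
    (m == true)%:R * r + (m == false)%:R * (1 - r).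
  rewrite /pushforward min_l// bernoulli_probE ?r0// !diracE.
  have mem b : (b \in nat_of_bool @^-1` [set m]) = (m == b).
    by apply/idP/eqP => [/set_mem/= <-|->] //; rewrite in_setE.
  by rewrite !mem /= mulrC [X in _ + X]mulrC.
apply: (@le_trans _ _ (1 + r * (expR theta - 1))); last exact: expR_ge1Dx.
under eq_bigr do rewrite pE.
apply: (@le_trans _ _ (\sum_(m < N.+2)
   expR (theta * m%:R) * ((m == 1 :> nat)%:R * r + (m == 0 :> nat)%:R * (1 - r)))).
  rewrite !big_ord_recr/= -addrA lerDl addr_ge0//.
    by rewrite mulr_ge0 ?expR_ge0// addr_ge0// mulr_ge0// subr_ge0.
  by rewrite mulr_ge0 ?expR_ge0// addr_ge0// mulr_ge0// subr_ge0.
rewrite !big_ord_recl/= big1 => [|m _]; last by rewrite !mul0r addr0 mulr0.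
by rewrite mulr0 expR0 mulr1 !mul0r !mul1r add0r !addr0; lra.
Qed.
End EdgeLaws.

(** From [expR (- x) >= 1 - x]: on [x <= 1/2], [(1 - x)^-1] is at most
    [1 + x + 2 x ^ 2], for either sign of [x]. *)
Lemma expR_le_quad {R : realType} (x : R) : x <= 2^-1 -> expR x - 1 <= x + 2 * x ^+ 2.
Proof.
move=> x2; have x1 : 0 < 1 - x by lra.
have ex : expR x <= (1 - x)^-1.
  by rewrite -[x in expR x]opprK expRN lef_pV2 ?posrE ?expR_gt0// expR_ge1Dx.
rewrite lerBlDr (le_trans ex)// -div1r ler_pdivrMr//.
have : 0 <= x ^+ 2 * (1 - 2 * x) by rewrite mulr_ge0 ?sqr_ge0//; lra.
by rewrite -subr_ge0 => h; rewrite -subr_ge0; move: h; congr (0 <= _); ring.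
Qed.

(** * Degrees given the weights *)

Section Degrees.
Context {d : measure_display} {T : measurableType d} {R : realType}.
Variables (P : probability T R) (n : nat).
Variables (W : 'I_n -> {RV P >-> R}) (A : 'I_n -> 'I_n -> {RV P >-> nat}).
Variable law : R -> set nat -> \bar R.
Hypothesis law_mgf : subpoisson_mgf law.
Hypothesis WA_graph : ordered_graph W A law.

Let G := sigma_generated (weight W).

Lemma measurable_weight j : measurable_fun setT (weight W j).
Proof. by apply: measurable_ostat => l; exact: measurable_funP. Qed.

Lemma sub_sigma_weight : G `<=` measurable.
Proof.
apply: smallest_sub; first exact: sigma_algebra_measurable.
move=> _ [j _ [B mB <-]]; exact: measurable_weight.
Qed.

Lemma sigma_weight_preimage j B : measurable B -> G (weight W j @^-1` B).
Proof.
move=> mB; apply: sub_sigma_algebra; exists j => //.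
by exists B => //; rewrite setTI.
Qed.

Lemma sigma_weightI (B C : set T) : G B -> G C -> G (B `&` C).
Proof.
exact: (@measurableI _ (g_sigma_algebraType
  (\bigcup_j preimage_set_system setT (weight W j) measurable))).
Qed.

Lemma sigma_weight_bigcap (I : finType) (B : I -> set T) :
  (forall j, G (B j)) -> G (\bigcap_j B j).
Proof.
move=> GB; apply: (@fin_bigcap_measurable _ (g_sigma_algebraType
  (\bigcup_j preimage_set_system setT (weight W j) measurable))) => // j _.
exact: GB.
Qed.

Lemma cond_prob_setT : cond_prob P G setT (cst 1).
Proof.
split.
- move=> B mB; rewrite preimage_cst; case: ifP => _.
    by have /= := @measurableT _ (g_sigma_algebraType
      (\bigcup_j preimage_set_system setT (weight W j) measurable)).
  exact: sigma_algebra0.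
- exact: finite_measure_integrable_cst.
- move=> B /sub_sigma_weight mB.
  by rewrite (integral_cst P mB 1%:E) mul1e setTI.
Qed.

(* Conditional laws are only given for pairs p with p.1 <= p.2. *)
Let edge (i j : 'I_n) : 'I_n * 'I_n := if (i <= j)%N then (i, j) else (j, i).

Let edge_le i j : ((edge i j).1 <= (edge i j).2)%N.
Proof. by rewrite /edge; case: ifPn => //=; rewrite -ltnNge => /ltnW. Qed.

Let edge_inj i : injective (edge i).
Proof.
move=> j l; rewrite /edge; case: ifPn => ij; case: ifPn => il [] //.
- by move=> -> ->.
- by move=> -> ->.
Qed.

Let edge_rate_edge i j w :
  edge_rate W (edge i j).1 (edge i j).2 w = edge_rate W i j w.
Proof. by rewrite /edge; case: ifP => //= _; rewrite /edge_rate [weight _ _ _ * _]mulrC. Qed.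

Let A_edge i j w : A (edge i j).1 (edge i j).2 w = A i j w.
Proof. by rewrite /edge; case: ifP => //= _; case: WA_graph. Qed.

(** The [n] edges at a given node are among the independent ones, up to the
    symmetry of the graph; the constraint on all other pairs is trivial, with
    conditional probability 1. *)
Lemma cond_prob_edges i (v : 'I_n -> nat) :
  cond_prob P G (\bigcap_j (A i j @^-1` [set v j]))
    (fun w => \prod_j fine (law (edge_rate W i j w) [set v j])).
Proof.
case: WA_graph => A_sym A_indep A_law.
pose S (p : 'I_n * 'I_n) : set nat :=
  if [pick j | edge i j == p] is Some j then [set v j] else setT.
pose f (p : 'I_n * 'I_n) w : R := if [pick j | edge i j == p] is Some j
  then fine (law (edge_rate W p.1 p.2 w) [set v j]) else 1.
have pick_edge j : [pick j' | edge i j' == edge i j] = Some j.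
  case: pickP => [j' /eqP/edge_inj ->//|/(_ j)].
  by rewrite eqxx.
have f_cond (p : 'I_n * 'I_n) : (p.1 <= p.2)%N -> cond_prob P G (A p.1 p.2 @^-1` S p) (f p).
  rewrite /S /f => p12; case: pickP => [j _|_]; first exact: A_law.
  by rewrite preimage_setT; exact: cond_prob_setT.
have := A_indep S f f_cond.
rewrite (_ : \bigcap_(p in _) _ = \bigcap_j (A i j @^-1` [set v j])); last first.
  apply/seteqP; split => w /= H.
    move=> j _ /=; have := H (edge i j) (edge_le i j).
    by rewrite /S/= pick_edge A_edge.
  move=> p _; rewrite /S; case: pickP => [j /eqP <-|//].
  by rewrite /= A_edge; exact: H.
rewrite (_ : (fun w => \prod_(p | _) _) =
  fun w => \prod_j fine (law (edge_rate W i j w) [set v j]))//.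
apply/funext => w; rewrite (bigID (mem (edge i @: [set: 'I_n]%SET)))/=.
rewrite [X in _ * X]big1 ?mulr1.
  rewrite (eq_bigl (mem (edge i @: [set: 'I_n]%SET))); last first.
    move=> p /=; apply: andb_idl => /imsetP[j _ ->]; exact: edge_le.
  rewrite big_imset/=; last by move=> ? ? _ _; exact: edge_inj.
  apply: eq_big => [j|j _]; first by rewrite inE.
  by rewrite /f pick_edge edge_rate_edge.
move=> p /andP[_ pN]; rewrite /f; case: pickP => [j /eqP ej|//].
by move: pN; rewrite -ej imset_f.
Qed.

Lemma measurable_degree i : measurable_fun setT (degree A i).
Proof.
have mA : measurable_fun setT (fun w => \sum_j A i j w)%N.
  by apply: measurable_sumn => j; exact: measurable_funP.
move=> _ B mB; exact: (mA _ [set k | B k%:R]).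
Qed.

(** The threshold in the Chernoff bound has to be deterministic whereas
    [weight W i] is random, so the bound is applied on a cell [B] on which
    [weight W i] stays within [h] of a constant [v]; this costs
    [2 * h * `|theta|] in the exponent.  The sign of [theta] selects the upper or the lower tail. *)
Lemma degree_chernoff i (B : set T) (theta delta h v M : R) : G B ->
  (forall w j, B w -> 0 <= edge_rate W i j w <= 1) ->
  (forall w, B w -> \sum_j edge_rate W i j w = weight W i w) ->
  (forall w, B w -> `|weight W i w - v| <= h) ->
  (forall w, B w -> weight W i w <= M) ->
  theta <= 2^-1 ->
  (P (B `&` [set w | (`|theta| * delta <=
                      theta * (degree A i w - weight W i w))%R]) <=
   (expR (2 * theta ^+ 2 * M - `|theta| * (delta - 2 * h)))%:E)%E.
Proof.
move=> GB B_rate B_sum B_cell B_le theta2.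
have mB := sub_sigma_weight GB.
pose kap j m w := fine (law (edge_rate W i j w) [set m]).
pose s := theta * v + `|theta| * (delta - h).
pose Lam := 2 * theta ^+ 2 * M + theta * v + `|theta| * h.
have cell w : B w -> `|theta * (weight W i w - v)| <= `|theta| * h.
  by move=> Bw; rewrite normrM ler_wpM2l// B_cell.
have mE (f g : T -> R) : measurable_fun setT f -> measurable_fun setT g ->
    measurable [set w | f w <= g w].
  by move=> mf mg; rewrite -[X in measurable X]setTI; exact: measurable_fun_le.
have mD : measurable_fun setT (degree A i) := measurable_degree i.
apply: (@le_trans _ _ (P (B `&` [set w | s <= theta * (\sum_j A i j w)%N%:R]))).
  apply: le_measure; rewrite ?inE.
  - apply: measurableI => //; apply: mE => //.
    by apply: measurable_funM => //; apply: measurable_funB => //; exact: measurable_weight.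
  - by apply: measurableI => //; apply: mE => //; exact: measurable_funM.
  move=> w [Bw /= dev]; split => //=; rewrite /s.
  have := cell w Bw; rewrite ler_norml => /andP[+ _].
  by move: dev; rewrite /degree; lra.
have -> : 2 * theta ^+ 2 * M - `|theta| * (delta - 2 * h) = Lam - s by rewrite /Lam /s; ring.
apply: (probability_chernoff (kap := kap)) => //.
- by move=> v'; have [] := cond_prob_edges i v'.
- by move=> v'; have [_ _ ->] := cond_prob_edges i v'.
move=> N w Bw; case: law_mgf => law_ge0 law_le.
apply: (@le_trans _ _ (\prod_j expR (edge_rate W i j w * (expR theta - 1)))).
  apply: ler_prod => j _; apply/andP; split; last by apply: law_le; exact: B_rate.
  by apply: sumr_ge0 => m _; rewrite mulr_ge0 ?expR_ge0//; exact: law_ge0.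
rewrite -expR_sum ler_expR -mulr_suml B_sum// /Lam.
have w0 : 0 <= weight W i w.
  by rewrite -B_sum// sumr_ge0// => j _; case/andP: (B_rate w j Bw).
apply: (@le_trans _ _ (weight W i w * (theta + 2 * theta ^+ 2))).
  by rewrite ler_wpM2l// expR_le_quad.
have := cell w Bw; rewrite ler_norml => /andP[_].
have : theta ^+ 2 * weight W i w <= theta ^+ 2 * M by rewrite ler_wpM2l ?sqr_ge0// B_le.
lra.
Qed.

(** The event on which degrees concentrate: the weights are positive and at most
    [M], and at least [i0.+1] of them exceed [m].  It is generated by the
    weights, so that conditional probabilities can be integrated over it. *)
Definition typical (i0 : 'I_n) (M m : R) : set T :=
  [set w | m < weight W i0 w] `&` \bigcap_j [set w | 0 < weight W j w <= M].

Lemma typical_sigma (i0 : 'I_n) (M m : R) : G (typical i0 M m).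
Proof.
apply: sigma_weightI.
  rewrite (_ : mkset _ = weight W i0 @^-1` `]m, +oo[).
    exact: sigma_weight_preimage.
  by apply/seteqP; split => w /=; rewrite in_itv/= andbT.
apply: sigma_weight_bigcap => j.
rewrite (_ : mkset _ = weight W j @^-1` `]0, M]).
  exact: sigma_weight_preimage.
by apply/seteqP; split => w /=; rewrite in_itv.
Qed.

Lemma sum_weight w : \sum_j weight W j w = \sum_l W l w.
Proof. exact: sum_ostat. Qed.

(** At least [i0.+1] weights exceed [m]. *)
Lemma typical_total (i0 : 'I_n) (M m : R) w : 0 < M -> 0 <= m -> M ^+ 2 <= i0.+1%:R * m ->
  typical i0 M m w -> 0 < \sum_l W l w /\ M ^+ 2 <= \sum_l W l w.
Proof.
move=> M0 m0 Mm [/= i0w allw].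
suff h : M ^+ 2 <= \sum_l W l w by split => //; rewrite (lt_le_trans _ h)// exprn_gt0.
rewrite (le_trans Mm)// -sum_weight.
apply: ostat_sum_ge => // [j|].
  by have /andP[/ltW] := allw j I.
by rewrite ostat_ostat.
Qed.

Lemma typical_edge_rate (i0 : 'I_n) (M m : R) i j w : 0 < M -> 0 <= m ->
  M ^+ 2 <= i0.+1%:R * m -> typical i0 M m w -> 0 <= edge_rate W i j w <= 1.
Proof.
move=> M0 m0 Mm typ; have [L0 ML] := typical_total M0 m0 Mm typ.
have [_ allw] := typ.
have /andP[wi0 wiM] := allw i I; have /andP[wj0 wjM] := allw j I.
rewrite /edge_rate divr_ge0 ?mulr_ge0 ?(ltW wi0) ?(ltW wj0) ?(ltW L0)//=.
by rewrite ler_pdivrMr// mul1r (le_trans _ ML)// expr2 ler_pM// ltW.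
Qed.

Lemma typical_sum_edge_rate (i0 : 'I_n) (M m : R) i w : 0 < M -> 0 <= m ->
  M ^+ 2 <= i0.+1%:R * m -> typical i0 M m w ->
  \sum_j edge_rate W i j w = weight W i w.
Proof.
move=> M0 m0 Mm typ; have [L0 _] := typical_total M0 m0 Mm typ.
by rewrite -mulr_suml -mulr_sumr sum_weight mulfK// gt_eqF.
Qed.

(** A union bound over the node, over cells of width [delta / 4] for its weight
    ([L] of them cover [0, M]) and over the two tails.  The value
    [delta / (8 M)] of [theta] makes the quadratic term half of the linear
    one. *)
Lemma degree_deviation (i0 : 'I_n) (M m delta : R) (L : nat) (E : set T) :
  0 < M -> 0 <= m -> M ^+ 2 <= i0.+1%:R * m ->
  0 < delta <= 4 * M -> M < L%:R * (delta / 4) ->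
  measurable E ->
  (forall w, E w -> exists i, delta <= `|degree A i w - weight W i w|) ->
  (P E <=
   P (~` typical i0 M m) + ((n * L * 2)%:R * expR (- (delta ^+ 2 / (32 * M))))%:E)%E.
Proof.
move=> M0 m0 Mm /andP[delta0 deltaM] ML mE E_dev.
pose h := delta / 4; have h0 : 0 < h by rewrite /h divr_gt0.
have mtyp : measurable (typical i0 M m) by apply: sub_sigma_weight; exact: typical_sigma.
have mdev (a b : R) i : measurable [set w | a <= b * (degree A i w - weight W i w)].
  rewrite -[X in measurable X]setTI; apply: measurable_fun_le => //.
  apply: measurable_funM => //; apply: measurable_funB.
    exact: measurable_degree.
  exact: measurable_weight.
pose theta (b : bool) : R := (-1) ^+ b * (delta / (8 * M)).
have M8 : 0 < 8 * M by rewrite mulr_gt0.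
have theta_norm b : `|theta b| = delta / (8 * M).
  by rewrite normrM normrX normrN1 expr1n mul1r ger0_norm// divr_ge0// ltW.
pose cell (p : 'I_n * 'I_L * bool) := typical i0 M m `&`
  weight W p.1.1 @^-1` `[p.1.2%:R * h, p.1.2.+1%:R * h].
pose C p := cell p `&` [set w | `|theta p.2| * delta <=
    theta p.2 * (degree A p.1.1 w - weight W p.1.1 w)].
have Gcell p : G (cell p).
  by apply: sigma_weightI; [exact: typical_sigma|exact: sigma_weight_preimage].
have C_bound p : (P (C p) <= (expR (- (delta ^+ 2 / (32 * M))))%:E)%E.
  have -> : - (delta ^+ 2 / (32 * M)) =
      2 * theta p.2 ^+ 2 * M - `|theta p.2| * (delta - 2 * h).
    rewrite -[theta p.2 ^+ 2]real_normK ?num_real// theta_norm /h.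
    by field; rewrite gt_eqF.
  apply: (@degree_chernoff p.1.1 (cell p) (theta p.2) delta h (p.1.2%:R * h) M) => //.
  - by move=> w j [typ _]; exact: typical_edge_rate typ.
  - by move=> w [typ _]; exact: typical_sum_edge_rate typ.
  - move=> w [_ /=]; rewrite in_itv/= -natr1 mulrDl mul1r => /andP[lo hi].
    by rewrite ger0_norm ?subr_ge0// lerBlDr addrC.
  - by move=> w [[_ allw] _]; case/andP: (allw p.1.1 I).
  - apply: (le_trans (ler_norm _)); rewrite theta_norm ler_pdivrMr//; lra.
have E_typ : (P (E `&` typical i0 M m) <= \sum_p P (C p))%E.
  apply: (@union_bound _ _ _ P _ xpredT) => [||w [/E_dev[i devi] typ]].
  - exact: measurableI.
  - by move=> p _; apply: measurableI; [exact: sub_sigma_weight|exact: mdev].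
  have [_ allw] := typ; have /andP[w0 wM] := allw i I.
  have lL : (Num.truncn (weight W i w / h) < L)%N.
    by rewrite truncn_lt_nat ?divr_ge0 ?ltW// ltr_pdivrMr// (le_lt_trans wM).
  exists (i, Ordinal lL, degree A i w - weight W i w < 0) => //; split => /=.
    have /truncn_itv/andP[lo hi] : 0 <= weight W i w / h by rewrite divr_ge0// ltW.
    split => //=; rewrite in_itv/=; apply/andP; split.
      by rewrite -ler_pdivlMr.
    by rewrite -ler_pdivrMr// ltW.
  rewrite theta_norm /theta/= [leRHS]mulrAC -normrEsign mulrC.
  by rewrite ler_wpM2r// divr_ge0// ltW.
apply: (@le_trans _ _ (P (~` typical i0 M m) + P (E `&` typical i0 M m))%E).
  rewrite -measureU//; first last.
  - by apply/seteqP; split => // w [] /= ? [].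
  - exact: measurableI.
  - exact: measurableC.
  apply: le_measure; rewrite ?inE//.
    by apply: measurableU; [exact: measurableC|exact: measurableI].
  by move=> w Ew; have [typ|] := pselect (typical i0 M m w); [right|left].
apply: leeD => //; apply: (le_trans E_typ).
apply: (@le_trans _ _ (\sum_(p : 'I_n * 'I_L * bool) (expR (- (delta ^+ 2 / (32 * M))))%:E)%E).
  exact: lee_sum.
rewrite sumEFin lee_fin sumr_const [leRHS]mulr_natl.
by rewrite !card_prod !card_ord card_bool.
Qed.

End Degrees.

(** * Independent weights *)

Section IidWeights.
Context {d : measure_display} {T : measurableType d} {R : realType}.
Variables (P : probability T R) (n : nat).
Variables (W : 'I_n -> {RV P >-> R}) (F : R -> R).
Hypothesis W_iid : iid_weights W F.

Let weight_leE j x : P (W j @^-1` `]-oo, x]) = (F x)%:E.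
Proof. by case: W_iid => _ /(_ j x). Qed.

Let weight_gtE j x : P (W j @^-1` `]x, +oo[) = (1 - F x)%:E.
Proof.
have mle : measurable (W j @^-1` `]-oo, x]) by exact: measurable_funPTI.
by rewrite -setCitvl preimage_setC (probability_setC P mle) weight_leE.
Qed.

Let weights_leE (J : {set 'I_n}) x :
  P (\bigcap_(j in [set j | j \in J]) (W j @^-1` `]-oo, x])) = (F x ^+ #|J|)%:E.
Proof.
case: W_iid => indep _.
pose B j : set R := if j \in J then `]-oo, x]%classic else setT.
have mB j : measurable (B j) by rewrite /B; case: ifP.
have := indep B mB; rewrite (_ : \bigcap_i _ =
    \bigcap_(j in [set j | j \in J]) (W j @^-1` `]-oo, x])); last first.
  apply/seteqP; split => w /= H j.
    by move=> jJ; have := H j I; rewrite /B jJ.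
  by move=> _; rewrite /B; case: ifP => // jJ; exact: H.
move=> ->; congr (_%:E); rewrite -prodr_const [RHS]big_mkcond.
apply: eq_bigr => j _; rewrite /B; case: ifP => // _; first by rewrite weight_leE.
by rewrite preimage_setT probability_setT.
Qed.

(** The indices below [i0.+1 * b] form [i0.+1] disjoint blocks of length [b].
    If every block contains an entry above [m], then at least [i0.+1] entries
    exceed [m], so that the order statistic of rank [i0.+1] does too.  Each
    block fails with probability [F m ^+ b]. *)
Lemma typicalC_bound (i0 : 'I_n) b M m : (i0.+1 * b <= n)%N ->
  (P (~` typical W i0 M m) <=
   (n%:R * F 0 + n%:R * (1 - F M) + i0.+1%:R * F m ^+ b)%:E)%E.
Proof.
move=> Kb; set K := i0.+1.
have blockP (r : 'I_K) (s : 'I_b) : (r * b + s < n)%N.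
  rewrite (leq_trans _ Kb)// (@leq_trans (r.+1 * b))//.
    by rewrite mulSn addnC ltn_add2r.
  by rewrite leq_mul2r ltn_ord orbT.
pose block r s := Ordinal (blockP r s).
have b_gt0 (s : 'I_b) : (0 < b)%N by case: s => s; exact: leq_ltn_trans.
have block_div r s : (block r s %/ b = r)%N.
  by rewrite /= divnMDl ?(b_gt0 s)// divn_small// addn0.
have block_inj r : injective (block r).
  by move=> s s' /(congr1 val)/= /addnI/val_inj.
pose B (p : 'I_n + 'I_n + 'I_K) : set T := match p with
  | inl (inl j) => W j @^-1` `]-oo, 0]
  | inl (inr j) => W j @^-1` `]M, +oo[
  | inr r => \bigcap_(j in [set j | j \in block r @: [set: 'I_b]%SET]) (W j @^-1` `]-oo, m])
  end.
have mWS j S : measurable S -> measurable (W j @^-1` S).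
  by move=> mS; exact: measurable_funPTI.
have mB p : measurable (B p).
  case: p => [[]|r] /=; [move=> j; exact: mWS..|].
  by apply: fin_bigcap_measurable => // j _; exact: mWS.
have := @union_bound _ _ _ P _ xpredT (~` typical W i0 M m) B.
rewrite !big_sumType/=.
under eq_bigr do rewrite weight_leE.
under [X in (_ + X + _)%E]eq_bigr do rewrite weight_gtE.
under [X in (_ + _ + X)%E]eq_bigr do rewrite weights_leE card_imset// cardsT card_ord.
rewrite !sumEFin !sumr_const !card_ord -!EFinD
  -[F 0 *+ n]mulr_natl -[(1 - F M) *+ n]mulr_natl -[F m ^+ b *+ K]mulr_natl.
apply => //; first by apply: measurableC; apply: sub_sigma_weight; exact: typical_sigma.
move=> w Ntyp; have [[p Bp]|NB] := pselect (exists p, B p w); first by exists p.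
case: Ntyp; split => [|j _] /=; last first.
  have [l jl] := ostat_mem (fun j => W j w) j; rewrite /weight jl; apply/andP; split.
    rewrite ltNge; apply/negP => Wl; apply: NB; exists (inl (inl l)) => /=.
    by rewrite in_itv.
  rewrite leNgt; apply/negP => Wl; apply: NB; exists (inl (inr l)) => /=.
  by rewrite in_itv/= andbT.
have big_entry r : exists s, m < W (block r s) w.
  apply: contrapT => small; apply: NB; exists (inr r) => /= j /imsetP[s _ ->].
  rewrite /= in_itv/= leNgt; apply/negP => ms; apply: small; by exists s.
have [f fP] := choice big_entry.
pose g r := block r (f r).
have g_inj : injective g.
  by move=> r r' /(congr1 (fun j : 'I_n => (j %/ b)%N)); rewrite !block_div => /val_inj.
rewrite /weight ostat_gt// -/K -(card_ord K) -(card_codom g_inj).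
apply/subset_leq_card/fintype.subsetP => _ /codomP[r ->].
by rewrite inE; exact: fP.
Qed.

End IidWeights.

(** * Powers, exponentials and the tail quantile function *)

Section PowerAsymptotics.
Context {R : realType}.
Implicit Types (a c s : R).

Lemma cvgy_natr_powR s : 0 < s -> n%:R `^ s @[n --> \oo] --> +oo.
Proof.
move=> s0; apply/cvgryPge => x; near=> n.
pose y := Num.max x 0; have y0 : 0 <= y by rewrite /y le_max lexx orbT.
apply: (@le_trans _ _ y); first by rewrite /y le_max lexx.
have -> : y = (y `^ s^-1) `^ s by rewrite -powRrM mulVf ?gt_eqF// powRr1.
rewrite ge0_ler_powR ?nnegrE ?powR_ge0 ?(ltW s0)//.
near: n; exact: nbhs_infty_ger.
Unshelve. all: end_near. Qed.

Lemma near_natr_powR_ge s c : 0 < s -> \forall n \near \oo, c <= n%:R `^ s.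
Proof. by move=> s0; have /cvgryPge := cvgy_natr_powR s0; exact. Qed.

Lemma cvg0_natr_powRN s : 0 < s -> n%:R `^ (- s) @[n --> \oo] --> (0 : R).
Proof.
move=> s0; under eq_fun do rewrite powRN.
apply/gtr0_cvgV0; last exact: cvgy_natr_powR.
by near=> n; rewrite powR_gt0// ltr0n; near: n; exact: nbhs_infty_gt.
Unshelve. all: end_near. Qed.

(** Comparison with a single term, of high degree, of the exponential series. *)
Lemma cvg0_natr_powR_expRN a c s : 0 < c -> 0 < s ->
  n%:R `^ a * expR (- (c * n%:R `^ s)) @[n --> \oo] --> (0 : R).
Proof.
move=> c0 s0.
(* The degree j is chosen so that s * j - a is at least 1. *)
pose j := (Num.truncn ((`|a| + 1) / s)).+1.
have sj : a + 1 <= s * j%:R.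
  rewrite (le_trans (lerD (ler_norm a) (lexx 1)))// mulrC -ler_pdivrMr//.
  by rewrite ltW// -truncn_lt_nat// divr_ge0// ?ltW// addr_gt0.
pose C := j`!%:R / c ^+ j.
have C0 : 0 <= C by rewrite divr_ge0// exprn_ge0// ltW.
apply: (@squeeze_cvgr _ _ _ _ (cst 0) (fun n => C * n%:R `^ (- 1))).
- near=> n; have n0 : 0 < n%:R :> R by rewrite ltr0n; near: n; exact: nbhs_infty_gt.
  have n1 : 1 <= n%:R :> R by rewrite ler1n -(ltr0n R).
  rewrite /= mulr_ge0 ?powR_ge0 ?expR_ge0//= expRN ler_pdivrMr ?expR_gt0//.
  have x0 : 0 <= c * n%:R `^ s by rewrite mulr_ge0 ?powR_ge0// ltW.
  have := @expR_ge1Dxn R _ j.-1 x0; rewrite prednK// => ex.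
  apply: (@le_trans _ _ (C * n%:R `^ (-1) * ((c * n%:R `^ s) ^+ j / j`!%:R))); last first.
    apply: ler_wpM2l; first by apply: mulr_ge0; rewrite ?powR_ge0.
    by rewrite (le_trans _ ex)// lerDr.
  have -> : (c * n%:R `^ s) ^+ j = c ^+ j * n%:R `^ (s * j%:R).
    by rewrite exprMn powRrM powR_mulrn ?powR_ge0.
  have -> : C * n%:R `^ (-1) * (c ^+ j * n%:R `^ (s * j%:R) / j`!%:R) =
      n%:R `^ (- 1) * n%:R `^ (s * j%:R).
    rewrite /C; field; rewrite gt_eqF ?ltr0n ?fact_gt0//= expf_neq0// gt_eqF//.
  rewrite -powRD; last by apply/implyP => _; rewrite gt_eqF.
  by rewrite ler_powR//; lra.
- exact: cvg_cst.
- rewrite -[X in _ --> X](mulr0 C); apply: cvgMr; exact: cvg0_natr_powRN.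
Unshelve. all: end_near. Qed.

End PowerAsymptotics.

Section TailQuantile.
Context {R : realType}.
Variables (F : cumulativeBounded (0 : R) (1 : R)) (gamma : R).
Hypothesis F_cont : continuous F.
Hypothesis F_pos : forall x : R, x <= 0 -> F x = 0.

Lemma cdf_ndecr : {homo F : x y / x <= y}.
Proof. exact: cumulative_is_nondecreasing. Qed.

Lemma cdf_nneg x : 0 <= F x.
Proof.
have [x0|x0] := leP x 0; first by rewrite F_pos.
by have := cdf_ndecr (ltW x0); rewrite (F_pos (lexx 0)).
Qed.

(** Continuity of [F] makes the infimum defining [tailU] attained. *)
Lemma tailU_quantile t : 1 < t -> 1 - t^-1 <= F (tailU F t) /\
  forall x, 1 - t^-1 <= F x -> tailU F t <= x.
Proof.
move=> t1; set y := 1 - t^-1.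
have t0 : 0 < t by rewrite (lt_trans _ t1).
have y0 : 0 < y by rewrite subr_gt0 invf_lt1.
have y1 : y < 1 by rewrite ltrBlDr ltrDl invr_gt0.
have A_lb : lbound [set x | y <= F x] 0.
  move=> x /= yx; rewrite leNgt; apply/negP => /ltW /F_pos Fx.
  by move: yx; rewrite Fx leNgt y0.
have A_inf : has_inf [set x | y <= F x].
  split; last by exists 0.
  have /cvgrPdist_lt/(_ (1 - y)) := cumulativey F.
  rewrite subr_gt0 => /(_ y1) [x [_ xF]].
  exists (x + 1) => /=; have := xF (x + 1); rewrite ltrDl ltr01 => /(_ isT).
  by move/(le_lt_trans (ler_norm _)); lra.
split; last by move=> x yx; apply: ge_inf => //; exists 0.
rewrite leNgt; apply/negP => Fu.
have /cvgrPdist_lt/(_ (y - F (tailU F t))) := F_cont (x := tailU F t).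
rewrite subr_gt0 => /(_ Fu) [e /= e0 He].
have [x yx xu] := inf_adherent e0 A_inf.
have ux : tailU F t <= x by apply: ge_inf => //; exists 0.
have : ball (tailU F t) e x.
  by rewrite /ball/= distrC ger0_norm ?subr_ge0// ltrBlDl.
by move=> /He; rewrite distrC => /(le_lt_trans (ler_norm _)); move: yx => /=; lra.
Qed.

Lemma tailU_gt0 t : 1 < t -> 0 < tailU F t.
Proof.
move=> t1; have [yU _] := tailU_quantile t1.
rewrite ltNge; apply/negP => /F_pos FU; move: yU; rewrite FU leNgt subr_gt0.
by rewrite invf_lt1 ?t1// (lt_trans _ t1).
Qed.

Lemma tailU_ndecr s t : 1 < s -> s <= t -> tailU F s <= tailU F t.
Proof.
move=> s1 st; have [_ sU] := tailU_quantile s1.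
have t1 := lt_le_trans s1 st; have [tU _] := tailU_quantile t1.
apply: sU; rewrite (le_trans _ tU)// lerB// lef_pV2 ?posrE//.
  by rewrite (lt_trans _ t1).
by rewrite (lt_trans _ s1).
Qed.

Lemma survival_le t x : 1 < t -> tailU F t <= x -> 1 - F x <= t^-1.
Proof.
move=> t1 Ux; have [tU _] := tailU_quantile t1.
by have := le_trans tU (cdf_ndecr Ux); lra.
Qed.

Hypothesis U_rv : forall x : R, 0 < x ->
  tailU F (t * x) / tailU F t @[t --> +oo] --> x `^ gamma.

(** The upper Potter bound: the limit at [x = 2] makes [tailU F] grow by a factor
    at most [2 `^ g] at each doubling beyond some [t1], and monotonicity fills
    the gaps between the powers of 2. *)
Lemma tailU_le_powR g : gamma < g -> 0 < g -> exists t1 C : R,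
  [/\ 1 < t1, 0 < C & forall t, t1 <= t -> tailU F t <= C * t `^ g].
Proof.
move=> gamma_g g0.
have [t1 [t1_gt1 U2]] : exists t1 : R, 1 < t1 /\
    forall t, t1 <= t -> tailU F (t * 2) <= 2 `^ g * tailU F t.
  have h2 : 2 `^ gamma < 2 `^ g :> R.
    by rewrite /powR gt_eqF// ltr_expR ltr_pM2r// ln_gt0// ltr1n.
  have two_gt0 : 0 < 2 :> R by [].
  have /cvgrPdist_lt/(_ (2 `^ g - 2 `^ gamma)) := U_rv two_gt0.
  rewrite subr_gt0 => /(_ h2) [t1 [_ Ht1]].
  have m1 : t1 <= Num.max t1 1 by rewrite le_max lexx.
  have m2 : 1 <= Num.max t1 1 by rewrite le_max lexx orbT.
  exists (Num.max t1 1 + 1); split=> [|t tt]; first by lra.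
  have t_gt1 : 1 < t by lra.
  have /Ht1 : t1 < t by lra.
  rewrite distrC => /(le_lt_trans (ler_norm _)).
  by rewrite ltrD2r ltr_pdivrMr ?tailU_gt0// => /ltW.
have t1_gt0 : 0 < t1 by rewrite (lt_trans _ t1_gt1).
have t1_2 : 1 < t1 * 2 by lra.
pose C := tailU F (t1 * 2) / t1 `^ g.
have C0 : 0 < C by rewrite divr_gt0 ?powR_gt0// tailU_gt0.
have base t : t1 <= t -> t <= t1 * 2 -> tailU F t <= C * t `^ g.
  move=> t1t tt1; have t_gt1 := lt_le_trans t1_gt1 t1t.
  apply: (le_trans (tailU_ndecr t_gt1 tt1)).
  rewrite /C mulrAC -mulrA ler_peMr ?(ltW (tailU_gt0 _))//.
  rewrite ler_pdivlMr ?powR_gt0// mul1r ge0_ler_powR ?nnegrE ?(ltW g0) ?(ltW t1_gt0)//.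
  by rewrite (le_trans (ltW t1_gt0)).
have claim j t : t1 <= t -> t <= t1 * 2 ^+ j.+1 -> tailU F t <= C * t `^ g.
  elim: j t => [|j IHj] t t1t tj; first by apply: base => //; rewrite expr1 in tj.
  have [tt1|tt1] := leP t (t1 * 2); first exact: base.
  have h1 : t1 <= t / 2 by lra.
  have h2 : t / 2 <= t1 * 2 ^+ j.+1 by move: tj; rewrite [2 ^+ j.+2]exprS; lra.
  rewrite -[t in tailU F t](divfK (_ : 2 != 0))//.
  apply: (le_trans (U2 _ h1)).
  have -> : C * t `^ g = 2 `^ g * (C * (t / 2) `^ g).
    rewrite [RHS]mulrCA -powRM//; first by rewrite [2 * _]mulrC divfK.
    by rewrite (le_trans _ h1)// ltW.
  by rewrite ler_wpM2l ?powR_ge0// IHj.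
exists t1, C; split => // t t1t.
pose j := Num.truncn (t / t1); apply: (claim j) => //.
rewrite -ler_pdivrMl// mulrC; apply: (@le_trans _ _ j.+1%:R).
  by rewrite ltW// -truncn_lt_nat// divr_ge0 ?(ltW t1_gt0)// (le_trans _ t1t) ?ltW.
by rewrite -natrX ler_nat ltnW// ltn_expl.
Qed.

(** The lower bound on the quotients, read at a fixed base point [t1]. *)
Lemma tailU_ge_powR (eta t0 : R) : 0 < t0 -> 0 <= eta < 1 ->
  (forall t x : R, t0 <= t -> 1 <= x ->
    (1 - eta) * x `^ gamma + eta <= tailU F (t * x) / tailU F t) ->
  exists t1 c : R, [/\ 1 < t1, 0 < c & forall t, t1 <= t -> c * t `^ gamma <= tailU F t].
Proof.
move=> t0_gt0 /andP[eta0 eta1] U_lower.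
pose t1 := t0 + 1; have t1_gt1 : 1 < t1 by rewrite /t1; lra.
have t1_gt0 : 0 < t1 by lra.
have U1 := tailU_gt0 t1_gt1.
exists t1, ((1 - eta) * tailU F t1 / t1 `^ gamma); split => //.
  by rewrite divr_gt0 ?powR_gt0// mulr_gt0// subr_gt0.
move=> t t1t; have t_gt0 : 0 <= t by lra.
have t01 : t0 <= t1 by rewrite /t1; lra.
have x1 : 1 <= t / t1 by rewrite ler_pdivlMr// mul1r.
have := U_lower t1 (t / t1) t01 x1.
rewrite [t1 * _]mulrC divfK ?gt_eqF// ler_pdivlMr//; apply: le_trans.
have -> : (t / t1) `^ gamma = t `^ gamma / t1 `^ gamma.
  by rewrite powRM// ?invr_ge0 ?(ltW t1_gt0)// -powR_inv1 ?(ltW t1_gt0)// -powRrM mulN1r powRN.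
have -> : ((1 - eta) * (t `^ gamma / t1 `^ gamma) + eta) * tailU F t1 =
  (1 - eta) * tailU F t1 / t1 `^ gamma * t `^ gamma + eta * tailU F t1 by ring.
by rewrite lerDl mulr_ge0// ltW.
Qed.

(** An upper bound [C * t `^ g] on the quantile inverts to a lower bound on [F]:
    at [x = C * t `^ g], [1 - F x] is at most [t^-1]. *)
Lemma expected_exceedances_le beta : 0 < gamma -> gamma < beta ->
  exists C s : R, 0 < s /\
    \forall n \near \oo, n%:R * (1 - F (n%:R `^ beta)) <= C * n%:R `^ (- s).
Proof.
move=> gamma0 gb; pose g := (gamma + beta) / 2.
have gg : gamma < g by rewrite /g; lra.
have g_gt0 : 0 < g by lra.
have g_b : g < beta by rewrite /g; lra.
have [t1 [C [t1_gt1 C0 UC]]] := tailU_le_powR gg g_gt0.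
have t1_gt0 : 0 < t1 by lra.
exists (C `^ g^-1), (beta / g - 1); split.
  by rewrite subr_gt0 ltr_pdivlMr// mul1r.
have beta0 : 0 < beta by lra.
near=> n.
have n0 : 0 < n%:R :> R by rewrite ltr0n; near: n; exact: nbhs_infty_gt.
pose x : R := n%:R `^ beta; pose t := (x / C) `^ g^-1.
have x0 : 0 < x by rewrite powR_gt0.
have xC : t1 `^ g <= x / C.
  rewrite ler_pdivlMr// /x; near: n; exact: near_natr_powR_ge.
have t1t : t1 <= t.
  have -> : t1 = (t1 `^ g) `^ g^-1 by rewrite -powRrM mulfV ?gt_eqF// powRr1// ltW.
  by rewrite ge0_ler_powR ?nnegrE ?powR_ge0 ?invr_ge0 ?(ltW g_gt0)// divr_ge0 ?ltW.
have Ux : tailU F t <= x.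
  apply: (le_trans (UC _ t1t)).
  rewrite /t -powRrM mulVf ?gt_eqF// powRr1; last by rewrite divr_ge0 ?ltW.
  by rewrite mulrC divfK ?gt_eqF.
have := survival_le (lt_le_trans t1_gt1 t1t) Ux; rewrite -(ler_pM2l n0) => /le_trans; apply.
have -> : t^-1 = C `^ g^-1 * n%:R `^ (- (beta / g)).
  rewrite /t -powRN powRM ?invr_ge0 ?(ltW x0) ?(ltW C0)//.
  rewrite -[C^-1]powR_inv1 ?(ltW C0)// /x -!powRrM mulrC.
  by congr (_ `^ _ * _ `^ _); field; rewrite gt_eqF.
rewrite mulrCA ler_wpM2l ?powR_ge0// -[X in X * _](powRr1 (ltW n0)).
rewrite -powRD; last by apply/implyP => _; rewrite gt_eqF.
by rewrite opprB.
Unshelve. all: end_near. Qed.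

Lemma cdf_le_half_near0 : exists m : R, 0 < m /\ F m <= 2^-1.
Proof.
have /cvgrPdist_lt/(_ 2^-1) := F_cont (x := 0).
rewrite invr_gt0 => /(_ (ltr0n _ 2)) [e /= e0 He].
exists (e / 2); split; first by rewrite divr_gt0.
have : ball 0 e (e / 2).
  by rewrite /ball/= sub0r normrN ger0_norm ?divr_ge0 ?(ltW e0)//; lra.
by move=> /He; rewrite (F_pos (lexx 0)) sub0r normrN => /(le_lt_trans (ler_norm _)) /ltW.
Qed.
End TailQuantile.

(** * Choice of the scales *)

Section Scales.
Context {R : realType}.

(** The block length [b] is about [n `^ zeta], so that there are about
    [n `^ (2 * beta + zeta)] blocks; the spare factor [n `^ zeta] absorbs the
    constant [m]. *)
Lemma near_blocks (beta zeta m : R) : 0 < beta -> 0 < zeta ->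
  2 * beta + 2 * zeta = 1 -> 0 < m ->
  \forall n \near \oo, exists K b : nat, [/\ (K.+1 * b <= n)%N,
    (n%:R `^ beta) ^+ 2 <= K.+1%:R * m & n%:R `^ zeta <= b%:R].
Proof.
move=> beta0 zeta0 bz1 m0; near=> n.
have n0 : 0 < n%:R :> R by rewrite ltr0n; near: n; exact: nbhs_infty_gt.
have n1 : 1 <= n%:R :> R by rewrite ler1n -(ltr0n R).
have z2 : 2 <= n%:R `^ zeta by near: n; exact: near_natr_powR_ge.
have zm : 4 / m <= n%:R `^ zeta by near: n; exact: near_natr_powR_ge.
pose x : R := n%:R `^ beta; pose y : R := n%:R `^ zeta.
have nE : n%:R = x ^+ 2 * y ^+ 2.
  rewrite -exprMn -powRD; last by apply/implyP => _; rewrite gt_eqF.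
  rewrite -powR_mulrn ?powR_ge0// -powRrM (_ : _ * _ = 1) ?(powRr1 (ltW n0))//; lra.
have x1 : 1 <= x by rewrite /x -[leLHS](powRr0 n%:R) ler_powR// ltW.
have x21 : 1 <= x ^+ 2 by rewrite exprn_ege1.
have y0 : 0 <= y by rewrite powR_ge0.
pose b := (Num.truncn y).+1.
have yb : y <= b%:R by rewrite ltW// -truncn_lt_nat.
have by2 : b%:R <= 2 * y.
  have ty : (Num.truncn y)%:R <= y by rewrite truncn_le.
  by rewrite /b -natr1; rewrite -/y in z2; lra.
have bn : (b <= n)%N.
  rewrite -(ler_nat R) nE (le_trans by2)//.
  rewrite -/y in z2; nra.
have K0 : (0 < n %/ b)%N by rewrite divn_gt0.
exists (n %/ b).-1, b; rewrite prednK//; split => //; first exact: leq_trunc_div.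
have nK : n%:R <= 2 * (n %/ b)%:R * b%:R :> R.
  have : (n <= 2 * (n %/ b) * b)%N.
    have b_gt0 : (0 < b)%N by [].
    by rewrite (leq_trans (ltnW (ltn_ceil n b_gt0)))// leq_mul2r
      mul2n -addnn -addn1 leq_add2l K0 orbT.
  by rewrite -(ler_nat R) !natrM.
rewrite -/x; rewrite -/y in zm z2.
have my : 4 <= m * y by rewrite mulrC -ler_pdivrMr.
have K4 : x ^+ 2 * y <= 4 * (n %/ b)%:R.
  have : x ^+ 2 * y * y <= 4 * (n %/ b)%:R * y.
    rewrite -mulrA -expr2 -nE (le_trans nK)//.
    have : (n %/ b)%:R * b%:R <= (n %/ b)%:R * (2 * y) :> R by rewrite ler_wpM2l.
    lra.
  by rewrite ler_pM2r//; lra.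
have : x ^+ 2 * 4 <= x ^+ 2 * (m * y) by rewrite ler_wpM2l//; lra.
have : m * (x ^+ 2 * y) <= m * (4 * (n %/ b)%:R) by rewrite ler_wpM2l// ltW.
lra.
Unshelve. all: end_near. Qed.

(** [(4 * alpha + 1)^-1] is below [(4 * alpha)^-1], which is [gamma / 4], and
    the logarithmic factor is at least 1. *)
Lemma near_k_le (alpha gamma : R) (k : nat -> nat) : 0 < alpha -> gamma = alpha^-1 ->
  (k n)%:R * (ln n%:R) `^ alpha / n%:R `^ (4 * alpha + 1)^-1 @[n --> \oo] --> (0 : R) ->
  \forall n \near \oo, (k n)%:R <= n%:R `^ (gamma / 4).
Proof.
move=> alpha0 gammaE /cvgrPdist_lt/(_ 1 ltr01) k_small; near=> n.
have n0 : 0 < n%:R :> R by rewrite ltr0n; near: n; exact: nbhs_infty_gt.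
have n1 : 1 <= n%:R :> R by rewrite ler1n -(ltr0n R).
have ln1 : 1 <= (ln n%:R) `^ alpha :> R.
  rewrite -[leLHS](powRr0 (ln n%:R)); apply: ler_powR; last exact: ltW.
  rewrite -[leLHS](expRK 1) ler_ln ?posrE ?expR_gt0//.
  near: n; exact: nbhs_infty_ger.
have p0 : 0 < n%:R `^ (4 * alpha + 1)^-1 :> R by rewrite powR_gt0.
have kn : (k n)%:R * (ln n%:R) `^ alpha <= n%:R `^ (4 * alpha + 1)^-1 :> R.
  rewrite -[leRHS]mul1r -ler_pdivrMr//.
  have : `|0 - (k n)%:R * (ln n%:R) `^ alpha / n%:R `^ (4 * alpha + 1)^-1| < 1 :> R.
    by near: n.
  by rewrite sub0r normrN => /(le_lt_trans (ler_norm _)) /ltW.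
rewrite (le_trans _ (le_trans kn _))//; first by rewrite ler_peMr.
rewrite ler_powR// gammaE -invfM lef_pV2 ?posrE; lra.
Unshelve. all: end_near. Qed.

(** With [k <= n `^ (gamma / 4)] and [gamma < 1/2],
    [sqrt k * k `^ gamma <= k <= n `^ (gamma / 4)], which is the ratio of
    [n `^ gamma] and [n `^ (3 * gamma / 4)]. *)
Lemma near_noise_below_signal (gamma t1 c eps : R) (U : R -> R) (k : nat -> nat) :
  0 < gamma -> gamma < 2^-1 -> 0 < c -> 0 < eps ->
  (forall n, (0 < k n)%N) ->
  (\forall n \near \oo, (k n)%:R <= n%:R `^ (gamma / 4) :> R) ->
  (forall t, t1 <= t -> c * t `^ gamma <= U t) ->
  \forall n \near \oo,
    Num.sqrt (k n)%:R * (2 * (eps * c / 2 * n%:R `^ (3 * gamma / 4))) <=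
      eps * U (n%:R / (k n)%:R).
Proof.
move=> gamma0 gamma_half c0 eps0 k0 k_le U_ge; near=> n.
have n0 : 0 < n%:R :> R by rewrite ltr0n; near: n; exact: nbhs_infty_gt.
have n1 : 1 <= n%:R :> R by rewrite ler1n -(ltr0n R).
have kn : (k n)%:R <= n%:R `^ (gamma / 4) :> R by near: n.
have kn0 : 0 < (k n)%:R :> R by rewrite ltr0n.
have kn1 : 1 <= (k n)%:R :> R by rewrite ler1n.
have nk : t1 <= n%:R / (k n)%:R.
  apply: (@le_trans _ _ (n%:R `^ (1 - gamma / 4))).
    near: n; apply: near_natr_powR_ge; lra.
  rewrite powRB; last by apply/implyP => _; rewrite gt_eqF.
  by rewrite (powRr1 (ltW n0)) ler_pM2l// lef_pV2 ?posrE ?powR_gt0.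
apply: (@le_trans _ _ (eps * (c * (n%:R / (k n)%:R) `^ gamma))); last first.
  by rewrite ler_pM2l// U_ge.
have -> : (n%:R / (k n)%:R) `^ gamma = n%:R `^ gamma / (k n)%:R `^ gamma.
  by rewrite powRM ?invr_ge0 ?(ltW n0) ?(ltW kn0)//
    -(powR_inv1 (ltW kn0)) -powRrM mulN1r powRN.
have -> : Num.sqrt (k n)%:R * (2 * (eps * c / 2 * n%:R `^ (3 * gamma / 4))) =
  eps * (c * (Num.sqrt (k n)%:R * n%:R `^ (3 * gamma / 4))) by field.
rewrite ler_pM2l// ler_pM2l// ler_pdivlMr ?powR_gt0//.
have -> : n%:R `^ gamma = n%:R `^ (3 * gamma / 4) * n%:R `^ (gamma / 4) :> R.
  rewrite -powRD; last by apply/implyP => _; rewrite gt_eqF.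
  by congr (_ `^ _); field.
rewrite mulrAC mulrC ler_pM2l ?powR_gt0// (le_trans _ kn)//.
rewrite -(powR12_sqrt (ltW kn0)) -powRD; last by apply/implyP => _; rewrite gt_eqF.
rewrite -[leRHS](powRr1 (ltW kn0)) ler_powR//; lra.
Unshelve. all: end_near. Qed.

End Scales.

(** * Comparison of the two estimators *)

Lemma Ihat_deviation {d : measure_display} {T : measurableType d} {R : realType}
    (P : probability T R) n (W : 'I_n -> {RV P >-> R})
    (A : 'I_n -> 'I_n -> {RV P >-> nat}) q k (sk a eps delta : R) w :
  0 <= sk -> 0 < a -> 0 <= delta -> sk * (2 * delta) <= eps * a ->
  eps < `|sk * `|Ihat q k (fun i => degree A i w) / a
                - Ihat q k (fun i => W i w) / a| - 0| ->
  exists i, delta <= `|degree A i w - weight W i w|.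
Proof.
move=> sk0 a0 delta0 sd; apply: contraPP => /forallNP small.
apply/negP; rewrite -leNgt subr0 -mulrBl normrM normr_id normrM ger0_norm//.
rewrite [`|a^-1|]gtr0_norm ?invr_gt0// mulrA ler_pdivrMr// (le_trans _ sd)//.
rewrite ler_wpM2l// -(Ihat_ostat _ _ (fun i => W i w)) Ihat_lipschitz// => j.
by rewrite ltW// ltNge; apply/negP; exact: small.
Qed.

Theorem lemma14 (R : realType) (alpha gamma : R)
  (alpha_gt2 : 2 < alpha) (gammaE : gamma = alpha^-1)
  (F : cumulativeBounded (0 : R) (1 : R))
  (F_cont : continuous F)
  (F_pos : forall x : R, x <= 0 -> F x = 0)
  (U_rv : forall x : R, 0 < x ->
     tailU F (t * x) / tailU F t @[t --> +oo] --> x `^ gamma)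
  (U_lower : exists t0 eta : R, [/\ 0 < t0, 0 <= eta < 1 &
     forall t x : R, t0 <= t -> 1 <= x ->
       (1 - eta) * x `^ gamma + eta <= tailU F (t * x) / tailU F t])
  (d : nat -> measure_display) (T : forall n, measurableType (d n))
  (P : forall n, probability (T n) R)
  (W : forall n, 'I_n -> {RV (P n) >-> R})
  (A : forall n, 'I_n -> 'I_n -> {RV (P n) >-> nat})
  (W_iid : forall n, iid_weights (W n) F)
  (model : (forall n, norros_reittu (W n) (A n)) \/
           (forall n, chung_lu (W n) (A n)))
  (k : nat -> nat) (k_gt0 : forall n, (0 < k n)%N)
  (k_infty : k @ \oo --> \oo)
  (k_small : (k n)%:R * (ln n%:R) `^ alpha / n%:R `^ (4 * alpha + 1)^-1
     @[n --> \oo] --> (0 : R))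
  (q : nat) (hq : (q = 1 \/ q = 2)%N) :
  let a := fun t : R => gamma * tailU F t in
  cvg_in_probability P
    (fun n w => Num.sqrt (k n)%:R *
       `| Ihat q (k n) (fun i => degree (A n) i w) / a (n%:R / (k n)%:R)
          - Ihat q (k n) (fun i => W n i w) / a (n%:R / (k n)%:R) |) 0.
Proof.
move=> a eps eps0.
have alpha0 : 0 < alpha by lra.
have gamma0 : 0 < gamma by rewrite gammaE invr_gt0.
have gamma_half : gamma < 2^-1 by rewrite gammaE ltf_pV2 ?posrE.
have [law [law_mgf graph]] : exists law : R -> set nat -> \bar R,
    subpoisson_mgf law /\ forall n, ordered_graph (W n) (A n) law.
  case: model => H; [exists (fun r => poisson_prob r 0%N)|
    exists (fun r => pushforward (bernoulli_prob (Num.min r 1)) nat_of_bool)].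
    by split => //; exact: poisson_subpoisson.
  by split => //; exact: bernoulli_subpoisson.
have [t0 [eta [t0_gt0 eta01 U_low]]] := U_lower.
have [t1 [c [t1_gt1 c0 U_ge]]] := tailU_ge_powR F_cont F_pos t0_gt0 eta01 U_low.
(* Any exponent strictly between gamma and min (1/2, 3 gamma / 2) would do. *)
pose beta := gamma * (3 / 2 - gamma).
have gamma_beta : gamma < beta by rewrite /beta; nra.
have beta_half : beta < 2^-1 by rewrite /beta; nra.
have beta_32 : beta < 3 * gamma / 2 by rewrite /beta; nra.
pose zeta := 2^-1 - beta.
have zeta0 : 0 < zeta by rewrite /zeta; lra.
have beta0 : 0 < beta by lra.
have [m [m0 Fm]] := cdf_le_half_near0 F_cont F_pos.
have [C [s [s0 F_tail]]] := expected_exceedances_le F_cont F_pos U_rv gamma0 gamma_beta.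
pose ea := eps * gamma; have ea0 : 0 < ea by rewrite mulr_gt0.
pose c1 := ea * c / 2; have c10 : 0 < c1 by rewrite divr_gt0// mulr_gt0.
pose delta n : R := c1 * n%:R `^ (3 * gamma / 4).
pose u n : R := C * n%:R `^ (- s) + n%:R `^ 1 * expR (- (2^-1 * n%:R `^ zeta))
  + 2 * (n%:R `^ 2 * expR (- (c1 ^+ 2 / 32 * n%:R `^ (3 * gamma / 2 - beta)))).
have u0 : u n @[n --> \oo] --> (0 : R).
  rewrite /u -[X in _ --> X](_ : C * 0 + 0 + 2 * 0 = 0); last by rewrite !mulr0 !addr0.
  apply: cvgD; first apply: cvgD.
  - by apply: cvgMr; exact: cvg0_natr_powRN.
  - by apply: cvg0_natr_powR_expRN; rewrite ?invr_gt0.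
  - apply: cvgMr; apply: cvg0_natr_powR_expRN; last lra.
    by rewrite divr_gt0// exprn_gt0.
have k_le := near_k_le alpha0 gammaE k_small.
have signal := near_noise_below_signal gamma0 gamma_half c0 ea0 k_gt0 k_le U_ge.
have blocks := near_blocks beta0 zeta0 (_ : 2 * beta + 2 * zeta = 1) m0.
have {}blocks := blocks ltac:(rewrite /zeta; lra).
apply: (@squeeze_cvge _ _ _ _ (cst 0%E) _ (fun n => (u n)%:E)); last 2 first.
- exact: cvg_cst.
- by apply/fine_cvgP; split; [exact: nearW|exact: u0].
near=> n; rewrite measure_ge0/=.
have n0 : 0 < n%:R :> R by rewrite ltr0n; near: n; exact: nbhs_infty_gt.
have n1 : 1 <= n%:R :> R by rewrite ler1n -(ltr0n R).
have [K [b [Kb KM bz]]] : exists K b : nat, [/\ (K.+1 * b <= n)%N,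
    (n%:R `^ beta) ^+ 2 <= K.+1%:R * m & n%:R `^ zeta <= b%:R] by near: n.
have noise : Num.sqrt (k n)%:R * (2 * delta n) <= eps * a (n%:R / (k n)%:R).
  by rewrite /a mulrA; near: n.
have delta0 : 0 < delta n by rewrite mulr_gt0// powR_gt0.
(* The left-hand side of [noise] is positive. *)
have a0 : 0 < a (n%:R / (k n)%:R).
  rewrite -(pmulr_rgt0 _ eps0); apply: lt_le_trans noise.
  by apply: mulr_gt0; [rewrite sqrtr_gt0 ltr0n|exact: mulr_gt0].
pose M : R := n%:R `^ beta; have M0 : 0 < M by rewrite powR_gt0.
have deltaM : delta n <= 4 * M.
  rewrite /delta /M -[beta](subrK (3 * gamma / 4)).
  rewrite powRD; last by apply/implyP => _; rewrite gt_eqF.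
  rewrite mulrA ler_pM2r ?powR_gt0// mulrC -ler_pdivrMr//.
  by near: n; apply: near_natr_powR_ge; lra.
have Mdelta : M < n%:R * (delta n / 4).
  have h : (4 + 1) / c1 <= n%:R `^ (1 + 3 * gamma / 4 - beta).
    by near: n; apply: near_natr_powR_ge; lra.
  have -> : n%:R * (delta n / 4) = c1 / 4 * n%:R `^ (1 + 3 * gamma / 4 - beta) * M.
    rewrite -[RHS]mulrA -powRD; last by apply/implyP => _; rewrite gt_eqF.
    rewrite subrK powRD; last by apply/implyP => _; rewrite gt_eqF.
    by rewrite (powRr1 (ltW n0)) /delta; ring.
  rewrite ltr_pMl//; move: h; rewrite ler_pdivrMr//; lra.
have b0 : (0 < b)%N by rewrite -(ltr0n R) (lt_le_trans _ bz)// powR_gt0.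
have Kn : (K < n)%N by rewrite (leq_trans _ Kb)// leq_pmulr.
pose X w := Num.sqrt (k n)%:R *
  `|Ihat q (k n) (fun i => degree (A n) i w) / a (n%:R / (k n)%:R) -
    Ihat q (k n) (fun i => W n i w) / a (n%:R / (k n)%:R)|.
have mX : measurable_fun setT X.
  apply: measurable_funM => //; apply: measurableT_comp => //.
  apply: measurable_funB; apply: measurable_funM => //; apply: measurable_Ihat => j.
    exact: measurable_degree.
  exact: measurable_funP.
pose E : set (T n) := [set w | eps < `|X w - 0|].
have mE : measurable E.
  rewrite (_ : E = (fun w => `|X w - 0|) @^-1` `]eps, +oo[).
    rewrite -[Y in measurable Y]setTI.
    apply: (_ : measurable_fun setT (fun w => `|X w - 0|)) => //.
    by apply: measurableT_comp => //; exact: measurable_funB.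
  by apply/seteqP; split => w /=; rewrite in_itv/= andbT.
have E_dev w : E w -> exists i, delta n <= `|degree (A n) i w - weight (W n) i w|.
  by apply: (Ihat_deviation _ a0 (ltW delta0) noise); exact: sqrtr_ge0.
apply: (le_trans (degree_deviation law_mgf (graph n) (i0 := Ordinal Kn) M0 (ltW m0) KM
  _ Mdelta mE E_dev)); first by rewrite delta0.
apply: (le_trans (leeD (typicalC_bound (W_iid n) (i0 := Ordinal Kn) M m Kb) (lexx _))).
rewrite -EFinD lee_fin (F_pos _ (lexx 0)) mulr0 add0r /u.
apply: lerD; first apply: lerD.
- by rewrite /M; near: n.
- rewrite (powRr1 (ltW n0)); apply: ler_pM => //.
  + by rewrite exprn_ge0// cdf_nneg.
  + by rewrite ler_nat.
  have half : F m <= expR (- 2^-1).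
    by rewrite (le_trans Fm)// (le_trans _ (expR_ge1Dx _))//; lra.
  apply: (@le_trans _ _ (expR (- 2^-1) ^+ b)).
    by rewrite lerXn2r ?nnegrE ?cdf_nneg ?expR_ge0.
  by rewrite -expRM_natr ler_expR mulNr lerN2 ler_pM2l.
- rewrite !natrM -mulrA [X in _ <= X]mulrCA mulrA.
  have -> : delta n ^+ 2 / (32 * M) = c1 ^+ 2 / 32 * n%:R `^ (3 * gamma / 2 - beta).
    rewrite powRB; last by apply/implyP => _; rewrite gt_eqF.
    have -> : n%:R `^ (3 * gamma / 2) = n%:R `^ (3 * gamma / 4) ^+ 2 :> R.
      by rewrite -powR_mulrn ?powR_ge0// -powRrM; congr (_ `^ _); field.
    by rewrite /delta /M; field; rewrite gt_eqF// powR_gt0.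
  by rewrite (powR_mulrn 2 (ltW n0)) expr2 mulrA lexx.
Unshelve. all: end_near. Qed.
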